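(* Consider the online game for SumLoss with top-1 feedback and $m=3$ items. Then, for every learner's algorithm, there is an adversary strategy generating relevance vectors such that the expected regret of the learner is $\Omega(T^{2/3})$. That is, there are constants $c>0$ and $T_0$ such that for every $T\ge T_0$ and every (possibly randomized) learner's algorithm there exist $R_1,\dots,R_T\in\{0,1\}^3$ with $$\mathbb{E}\Big[\sum_{t=1}^T \mathrm{SumLoss}(\sigma_t,R_t)\Big]-\min_{\sigma}\sum_{t=1}^T\mathrm{SumLoss}(\sigma,R_t)\ \ge\ c\,T^{2/3}.$$
   Context: Items are numbered $1,\dots,m$. A permutation $\sigma$ maps ranks to items and $\sigma^{-1}$ maps items to ranks. $\mathrm{SumLoss}(\sigma,R)=\sum_{i=1}^m\sigma^{-1}(i)R(i)$ for $R\in\{0,1\}^m$. Online game over $T$ rounds with an oblivious adversary, who fixes relevance vectors $R_1,\dots,R_T\in\{0,1\}^m$: at round $t$ the learner outputs a permutation $\sigma_t$, possibly using internal randomization and based on the feedback received so far; it then suffers $\mathrm{SumLoss}(\sigma_t,R_t)$ but observes only $R_t(\sigma_t(1))$, the relevance of the top ranked item (top-1 feedback). Neither $R_t$ nor the loss is revealed. The minimum in the regret is over all permutations of the $m$ items; the expectation is over the learner's randomization. *)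

(* Defs.v *)
From mathcomp Require Import all_boot all_order all_algebra all_fingroup.
From mathcomp Require Import all_classical all_reals all_analysis.

Set Implicit Arguments.
Unset Strict Implicit.
Unset Printing Implicit Defensive.

Local Open Scope ring_scope.

(* Items and ranks are both 'I_m; the element of value k is the (k+1)-st item
   or rank.  A permutation s : 'S_m maps ranks to items. *)
Definition relevance (m : nat) := {ffun 'I_m -> bool}.

Definition SumLoss (m : nat) (s : 'S_m) (r : relevance m) : nat :=
  (\sum_(i < m) ((s^-1)%g i).+1 * r i)%N.

Definition top1 (m : nat) (s : 'S_m.+1) (r : relevance m.+1) : bool :=
  r (s ord0).

(* For a fixed value of the learner's internal randomness, the learner is a
   function from the feedback bits received so far (oldest first) to a
   permutation.  Its own past permutations are determined by these data, so
   they need not be further arguments.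
   Rounds are numbered from 0, and [rs t] is the relevance vector of round t;
   [feedback a rs t] is the feedback received in rounds 0, ..., t-1. *)
Fixpoint feedback (m : nat) (a : seq bool -> 'S_m.+1)
    (rs : nat -> relevance m.+1) (t : nat) : seq bool :=
  if t is t'.+1 then
    let h := feedback a rs t' in rcons h (top1 (a h) (rs t'))
  else [::].

Definition learner_loss (m : nat) (a : seq bool -> 'S_m.+1)
    (rs : nat -> relevance m.+1) (T : nat) : nat :=
  (\sum_(t < T) SumLoss (a (feedback a rs t)) (rs t))%N.

Definition fixed_loss (m : nat) (rs : nat -> relevance m) (T : nat)
    (s : 'S_m) : nat :=
  (\sum_(t < T) SumLoss s (rs t))%N.

Definition best_loss (m : nat) (rs : nat -> relevance m) (T : nat) : nat :=
  fixed_loss rs T [arg min_(s < 1%g) fixed_loss rs T s].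

(* A randomized learner draws w : Omega once, before the first round; this
   includes fresh randomization at every round.  Since permutations and
   feedback sequences form discrete countable sets, this measurability condition
   is what makes all the permutations output by the learner random variables. *)
Definition randomized_learner d (Omega : measurableType d) (m : nat)
    (A : Omega -> seq bool -> 'S_m) : Prop :=
  forall (h : seq bool) (s : 'S_m), measurable [set w | A w h = s]%classic.

Definition expected_regret (R : realType) d (Omega : measurableType d)
    (P : probability Omega R) (m : nat) (A : Omega -> seq bool -> 'S_m.+1)
    (rs : nat -> relevance m.+1) (T : nat) : \bar R :=
  ('E_P[fun w => (learner_loss (A w) rs T)%:R] - ((best_loss rs T)%:R)%:E)%E.

(* Main.v *)
(** The adversary always makes item 0 relevant and exactly one of the items 1, 2,
    chosen by i.i.d. biased coins with parameter (1 + e) / 2 or (1 - e) / 2, the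
    sign of the bias being uniform and e = T^(-1/3).  The feedback carries
    information only when item 0 is not on top, which costs about 1/2.  Let u, v
    be the unnormalised posterior weights of the two signs.  The quantity
    uv / (u + v) bounds from below the posterior weight of either sign, hence
    the price (in units of e) of ranking items 1 and 2 in the wrong order; and
    one observation decreases its expectation by at most a factor 1 - e^2.
    Backward induction then bounds the regret of n remaining rounds below by
    e n uv / (u + v) as long as e^3 n is bounded.  Since this holds for every
    deterministic learner, averaging over the internal randomness and the coins
    gives a fixed sequence with regret at least e T / 4 = T^(2/3) / 4. *)
Require Import Defs.
From mathcomp Require Import all_boot all_order all_algebra all_fingroup.
From mathcomp Require Import all_classical all_reals all_analysis.
From mathcomp Require Import zify ring lra.
Import Order.TTheory GRing.Theory Num.Theory.

Local Open Scope ring_scope.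

(** * Losses of a single round *)

Definition item1 : 'I_3 := lift ord0 ord0.

Definition item2 : 'I_3 := ord_max.

Definition bit_relevance (x : bool) : relevance 3 :=
  [ffun i => (i == ord0) || ((i == item1) == x)].

Definition bits_relevance (l : seq bool) (t : nat) : relevance 3 :=
  bit_relevance (nth false l t).

Lemma SumLoss_bit_relevance (s : 'S_3) x :
  SumLoss s (bit_relevance x) =
  ((s^-1)%g ord0 + (s^-1)%g (if x then item1 else item2)).+2.
Proof.
rewrite /SumLoss !big_ord_recl big_ord0 !ffunE /=.
have -> : lift ord0 (lift ord0 ord0) = item2 by exact: val_inj.
by case: x => /=; rewrite -/item1; lia.
Qed.

Lemma perm3_inj (s : 'S_3) :
  [/\ s ord0 <> s item1 :> nat, s ord0 <> s item2 :> nat &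
      s item1 <> s item2 :> nat].
Proof. by split=> /ord_inj/perm_inj. Qed.

Lemma SumLoss_exploit (s : 'S_3) : s ord0 = ord0 ->
  (SumLoss s (bit_relevance true) = 3 /\
   SumLoss s (bit_relevance false) = 4)%N \/
  (SumLoss s (bit_relevance true) = 4 /\
   SumLoss s (bit_relevance false) = 3)%N.
Proof.
move=> s0; have r0 : (s^-1)%g ord0 = ord0 by rewrite -{1}s0 permK.
have [h01 h02 h12] := perm3_inj (s^-1)%g.
rewrite !SumLoss_bit_relevance; move: h01 h02 h12; rewrite r0 /=.
have := ltn_ord ((s^-1)%g item1); have := ltn_ord ((s^-1)%g item2).
lia.
Qed.

(** The ranks of the three items sum to 6, so the losses for the two coins sum to 6 plus the rank of
    item 0, and they differ by the gap between the ranks of items 1 and 2. *)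
Lemma SumLoss_explore (s : 'S_3) : s ord0 <> ord0 ->
  [/\ 8 <= SumLoss s (bit_relevance true) + SumLoss s (bit_relevance false),
      SumLoss s (bit_relevance true) <= SumLoss s (bit_relevance false) + 2 &
      SumLoss s (bit_relevance false) <= SumLoss s (bit_relevance true) + 2]%N.
Proof.
move=> s0.
have r0 : (s^-1)%g ord0 <> (ord0 : 'I_3) :> nat.
  by move=> /ord_inj r0; apply: s0; rewrite -[X in s X = _]r0 permKV.
have [h01 h02 h12] := perm3_inj (s^-1)%g.
rewrite !SumLoss_bit_relevance; move: r0 h01 h02 h12 => /=.
have := ltn_ord ((s^-1)%g item1); have := ltn_ord ((s^-1)%g item2).
have := ltn_ord ((s^-1)%g ord0).
by move=> *; split; lia.
Qed.

(** * The game unrolled from its first round *)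

Lemma feedbackS m (a : seq bool -> 'S_m.+1) rs t :
  let b := top1 (a [::]) (rs 0%N) in
  feedback a rs t.+1 = b :: feedback (a \o cons b) (rs \o succn) t.
Proof.
have step a' rs' k : feedback a' rs' k.+1 =
    rcons (feedback a' rs' k) (top1 (a' (feedback a' rs' k)) (rs' k)) by [].
by move=> b; elim: t => [//|t IH]; rewrite step IH [in RHS]step.
Qed.

(** Once the bit [b] is received, [a \o cons b] is again a learner, facing the shifted sequence;
    backward induction rests on this. *)
Lemma learner_lossS m (a : seq bool -> 'S_m.+1) rs T :
  let b := top1 (a [::]) (rs 0%N) in
  learner_loss a rs T.+1 =
    (SumLoss (a [::]) (rs 0%N) +
     learner_loss (a \o cons b) (rs \o succn) T)%N.
Proof.
rewrite /learner_loss big_ord_recl; congr (_ + _)%N.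
by apply: eq_bigr => t _; rewrite lift0 feedbackS.
Qed.

(** * Expectation over independent coins *)

Section BitsMean.
Variable R : realType.
Implicit Types (p c : R) (f g : seq bool -> R).

(** Expectation of [f] over [n] independent coins, each true with probability [p]. Splitting off the
    first coin matches [learner_lossS]. *)
Fixpoint bits_mean p n f : R :=
  if n is n'.+1 then
    p * bits_mean p n' (f \o cons true) +
    (1 - p) * bits_mean p n' (f \o cons false)
  else f [::].

Lemma eq_bits_mean p n f g : f =1 g -> bits_mean p n f = bits_mean p n g.
Proof. by move=> /funext ->. Qed.

Lemma bits_mean_addl p n c f :
  bits_mean p n (fun l => c + f l) = c + bits_mean p n f.
Proof.
elim: n f => [//|n IH] f /=.
by rewrite !(IH (f \o cons _)); ring.
Qed.

Lemma bits_meanB p n f g :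
  bits_mean p n (fun l => f l - g l) = bits_mean p n f - bits_mean p n g.
Proof.
elim: n f g => [//|n IH] f g /=.
by rewrite !(IH (f \o cons _) (g \o cons _)); ring.
Qed.

Lemma ler_bits_mean p n f g : 0 < p < 1 ->
  (forall l, f l <= g l) -> bits_mean p n f <= bits_mean p n g.
Proof.
move=> /andP[p0 p1]; elim: n f g => [|n IH] f g fg /=; first exact: fg.
by apply: lerD; rewrite ler_pM2l ?subr_gt0//; apply: IH => l;
  exact: fg.
Qed.

Lemma bits_mean_lt p n f c : 0 < p < 1 ->
  (forall l, f l < c) -> bits_mean p n f < c.
Proof.
move=> /andP[p0 p1]; elim: n f => [|n IH] f fc /=; first exact: fc.
have /IH ht l : (f \o cons true) l < c by exact: fc.
have /IH hf l : (f \o cons false) l < c by exact: fc.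
have -> : c = p * c + (1 - p) * c by ring.
by apply: ltrD; rewrite ltr_pM2l ?subr_gt0.
Qed.

End BitsMean.

(** * Lower bound for a deterministic learner *)

Section Deterministic.
Variable R : realType.
Implicit Types (u v d : R).

Lemma fixed_loss_mean p n (s : 'S_3) :
  bits_mean R p n (fun l => (fixed_loss (bits_relevance l) n s)%:R) =
  n%:R * (p * (SumLoss s (bit_relevance true))%:R +
          (1 - p) * (SumLoss s (bit_relevance false))%:R).
Proof.
elim: n => [|n IH] /=; first by rewrite /fixed_loss big_ord0 mul0r.
have E x : bits_mean R p n
    ((fun l => (fixed_loss (bits_relevance l) n.+1 s)%:R) \o cons x) =
    (SumLoss s (bit_relevance x))%:R +
    bits_mean R p n (fun l => (fixed_loss (bits_relevance l) n s)%:R).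
  rewrite -bits_mean_addl; apply: eq_bits_mean => l /=.
  by rewrite /fixed_loss big_ord_recl natrD.
rewrite !E IH -natr1; ring.
Qed.

Lemma learner_loss_cons p n (a : seq bool -> 'S_3) x :
  bits_mean R p n
    ((fun l => (learner_loss a (bits_relevance l) n.+1)%:R) \o cons x) =
  (SumLoss (a [::]) (bit_relevance x))%:R +
  bits_mean R p n (fun l => (learner_loss
    (a \o cons (top1 (a [::]) (bit_relevance x))) (bits_relevance l) n)%:R).
Proof.
rewrite -bits_mean_addl; apply: eq_bits_mean => l /=.
by rewrite learner_lossS natrD.
Qed.

(** Half the harmonic mean of the two weights. *)
Definition ambiguity u v : R := u * v / (u + v).

Lemma ambiguity_le u v : 0 < u -> 0 < v ->
  [/\ ambiguity u v <= u, ambiguity u v <= v & 4 * ambiguity u v <= u + v].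
Proof.
move=> u0 v0; have uv : 0 < u + v by lra.
have u2 := sqr_ge0 u; have v2 := sqr_ge0 v; have d2 := sqr_ge0 (u - v).
by rewrite /ambiguity mulrA !ler_pdivrMr//; split; nra.
Qed.

Lemma ambiguity_split d u v : 0 < d -> d < 1 -> 0 < u -> 0 < v ->
  (1 - d ^+ 2) * ambiguity u v <=
  ambiguity (u * ((1 + d) / 2)) (v * ((1 - d) / 2)) +
  ambiguity (u * ((1 - d) / 2)) (v * ((1 + d) / 2)).
Proof.
move=> d0 d1 u0 v0; rewrite /ambiguity.
have uv : 0 < u + v by lra.
have h1 : 0 < u * (1 + d) + v * (1 - d) by nra.
have h2 : 0 < u * (1 - d) + v * (1 + d) by nra.
rewrite -subr_ge0.
(* Over a common denominator the difference of the two sides is a nonnegative multiple of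
   [(u - v) ^+ 2]. *)
have -> : u * ((1 + d) / 2) * (v * ((1 - d) / 2)) /
      (u * ((1 + d) / 2) + v * ((1 - d) / 2)) +
    u * ((1 - d) / 2) * (v * ((1 + d) / 2)) /
      (u * ((1 - d) / 2) + v * ((1 + d) / 2)) -
    (1 - d ^+ 2) * (u * v / (u + v)) =
    (1 - d ^+ 2) * u * v * d ^+ 2 * (u - v) ^+ 2 /
    ((u + v) * (u * (1 + d) + v * (1 - d)) * (u * (1 - d) + v * (1 + d))).
  field; rewrite !lt0r_neq0//; lra.
apply: divr_ge0; last by rewrite !mulr_ge0// ltW.
have h3 : 0 <= 1 - d ^+ 2 by rewrite subr_ge0 exprn_ile1// ltW.
by apply/(mulr_ge0 _ (sqr_ge0 _))/(mulr_ge0 _ (sqr_ge0 _));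
  rewrite mulr_ge0 ?(ltW v0)// mulr_ge0 ?(ltW u0).
Qed.

(* [7 / 2 - d / 2] is the mean loss per round of the best permutation, under
   either bias. *)
Lemma deterministic_regret d n (a : seq bool -> 'S_3) u v :
  0 < d -> d < 1 -> 0 < u -> 0 < v -> 3 * d + d ^+ 3 * n%:R <= 2 ->
  let L l := (learner_loss a (bits_relevance l) n)%:R in
  (u + v) * (n%:R * (7 / 2 - d / 2)) + d * n%:R * ambiguity u v <=
  u * bits_mean R ((1 + d) / 2) n L + v * bits_mean R ((1 - d) / 2) n L.
Proof.
move=> d0 d1; elim: n a u v => [|n IH] a u v u0 v0 dn /=.
  by rewrite /learner_loss big_ord0 !(mul0r, mulr0).
have dn' : 3 * d + d ^+ 3 * n%:R <= 2.
  by apply: le_trans dn; rewrite lerD2l ler_pM2l ?exprn_gt0// ler_nat.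
rewrite !learner_loss_cons.
have -> : 1 - (1 + d) / 2 = (1 - d) / 2 by field.
have -> : 1 - (1 - d) / 2 = (1 + d) / 2 by field.
rewrite -natr1 in dn *.
have n0 : 0 <= n%:R :> R by [].
have [g1 g2 g4] := ambiguity_le _ _ u0 v0.
have [s0|s0] := eqVneq (a [::] ord0) ord0.
  have t1 x : top1 (a [::]) (bit_relevance x) = true.
    by rewrite /top1 s0 ffunE.
  (* The constant bit leaves the weights unchanged. The order of items 1 and 2 is wrong for one
     sign, which costs [d] times its weight, at least [d * ambiguity u v]. *)
  rewrite !t1; have := IH (a \o cons true) _ _ u0 v0 dn'.
  move=> /=; set M1 := bits_mean _ _ _ _; set M2 := bits_mean _ _ _ _.
  by have [[-> ->]|[-> ->]] := SumLoss_exploit _ s0; nra.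
have [l1 l2 l3] := SumLoss_explore _ (elimN eqP s0).
move: l1 l2 l3; rewrite -!(ler_nat R) !natrD.
set St := (SumLoss _ (bit_relevance true))%:R.
set Sf := (SumLoss _ (bit_relevance false))%:R => l1 l2 l3.
have p0 : 0 < (1 + d) / 2 by lra.
have q0 : 0 < (1 - d) / 2 by lra.
(* By Bayes' rule each outcome of the coin multiplies the weights by its likelihoods [(1 + d) / 2]
   and [(1 - d) / 2]. *)
have := IH (a \o cons (top1 (a [::]) (bit_relevance true))) _ _
  (mulr_gt0 u0 p0) (mulr_gt0 v0 q0) dn'.
have := IH (a \o cons (top1 (a [::]) (bit_relevance false))) _ _
  (mulr_gt0 u0 q0) (mulr_gt0 v0 p0) dn'.
have := ambiguity_split _ _ _ d0 d1 u0 v0.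
move=> /=; set M1 := bits_mean _ _ _ _; set M2 := bits_mean _ _ _ _.
set M3 := bits_mean _ _ _ _; set M4 := bits_mean _ _ _ _.
set G := ambiguity u v; set G1 := ambiguity _ _; set G2 := ambiguity _ _.
move=> hG h1 h2.
have g0 : 0 <= G by rewrite /G /ambiguity divr_ge0// ?mulr_ge0// ltW// addr_gt0.
have dn0 : 0 <= d * n%:R by rewrite mulr_ge0// ltW.
have h3 := ler_wpM2l dn0 hG.
have h4 : 4 - d <= St * ((1 + d) / 2) + Sf * ((1 - d) / 2) by nra.
have h5 : 4 - d <= St * ((1 - d) / 2) + Sf * ((1 + d) / 2) by nra.
have h6 := ler_wpM2l (ltW u0) h4.
have h7 := ler_wpM2l (ltW v0) h5.
(* By [h4] and [h5] exploring costs at least [(1 - d) / 2] above the best mean loss. This pays for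
   the share [d * G] of the current round and for the drop [d ^+ 3 * n%:R * G] of the bound on later
   rounds. *)
have h8 : d * (1 + d ^+ 2 * n%:R) * G <= (1 - d) / 2 * (u + v).
  have : d * (1 + d ^+ 2 * n%:R) <= 2 - 2 * d.
    by move: dn'; rewrite (_ : d ^+ 3 = d * d ^+ 2) ?exprS//; lra.
  have d1' : 0 <= 1 - d by lra.
  move=> /(ler_wpM2r g0); have := ler_wpM2l d1' g4; rewrite -/G; lra.
nra.
Qed.

End Deterministic.

(** * Integration over the learner's randomness *)

Section Randomized.
Local Open Scope classical_set_scope.
Context {dsp : measure_display} {Omega : measurableType dsp} {R : realType}.
Variable P : probability Omega R.

Lemma measurable_preimage_fin (T : finType) (g : Omega -> T) (B : set T) :
  (forall t, measurable [set w | g w = t]) -> measurable (g @^-1` B).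
Proof.
move=> mg.
have -> : g @^-1` B = \bigcup_(t in B) [set w | g w = t].
  by apply/seteqP; split=> [w /= Bw|w [t Bt /= gwt]]; [exists (g w)|rewrite /preimage /= gwt].
by apply: fin_bigcup_measurable => //; exact: finite_finset.
Qed.

Lemma integrable_fin (T : finType) (g : Omega -> T) (f : T -> R) :
  (forall t, measurable [set w | g w = t]) ->
  P.-integrable setT (EFin \o (f \o g)).
Proof.
move=> mg; apply: measurable_bounded_integrable => //.
- by rewrite /= probability_setT ltry.
- by move=> _ Y mY; rewrite setTI comp_preimage; exact: measurable_preimage_fin.
- exists (\sum_t `|f t|); split=> [|M /ltW leM w _ /=]; first exact: num_real.
  by apply: le_trans leM; rewrite (bigD1 (g w))//= lerDl sumr_ge0.
Qed.

(** The first permutation takes finitely many values, and fixing it fixes the first bit. *)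
Lemma randomized_learner_shift m (A : Omega -> seq bool -> 'S_m.+1)
    (r : relevance m.+1) : randomized_learner A ->
  randomized_learner (fun w => A w \o cons (top1 (A w [::]) r)).
Proof.
move=> mA h s.
have -> : [set w | (A w \o cons (top1 (A w [::]) r)) h = s] =
    \bigcup_(s0 in [set: 'S_m.+1])
      ([set w | A w [::] = s0] `&` [set w | A w (top1 s0 r :: h) = s]).
  apply/seteqP; split=> [w /= Aw|w [s0 _ [/= <- //]]].
  by exists (A w [::]).
apply: fin_bigcup_measurable; first exact: finite_finset.
by move=> s0 _; apply: measurableI; exact: mA.
Qed.

Lemma integrable_learner_loss m (A : Omega -> seq bool -> 'S_m.+1) rs n :
  randomized_learner A ->
  P.-integrable setT (fun w => ((learner_loss (A w) rs n)%:R : R)%:E).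
Proof.
elim: n A rs => [|n IH] A rs mA.
  under eq_fun do rewrite /learner_loss big_ord0.
  exact: finite_measure_integrable_cst.
under eq_fun do rewrite learner_lossS natrD EFinD.
apply: integrableD => //.
  exact: (integrable_fin _ _ (fun s => (SumLoss s (rs 0%N))%:R) (mA [::])).
exact/IH/randomized_learner_shift.
Qed.

Lemma bits_mean_Rintegral p n (X : seq bool -> Omega -> R) :
  (forall l, P.-integrable setT (EFin \o X l)) ->
  P.-integrable setT (fun w => (bits_mean R p n (X ^~ w))%:E) /\
  \int[P]_w bits_mean R p n (X ^~ w) =
  bits_mean R p n (fun l => \int[P]_w X l w).
Proof.
elim: n X => [|n IH] X iX /=; first by split=> //; exact: iX.
have [it et] := IH (fun l => X (true :: l)) (fun l => iX (true :: l)).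
have [jf ef] := IH (fun l => X (false :: l)) (fun l => iX (false :: l)).
have kt := integrableZl measurableT p it.
have kf := integrableZl measurableT (1 - p) jf.
split; first exact: (integrableD measurableT kt kf).
by rewrite RintegralD// !RintegralZl// et ef.
Qed.

End Randomized.

(** * Averaging over coins and signs *)

Theorem corollary5 (R : realType) :
  exists (c : R) (T0 : nat), 0 < c /\
    forall T : nat, (T0 <= T)%N ->
    forall (d : measure_display) (Omega : measurableType d)
      (P : probability Omega R) (A : Omega -> seq bool -> 'S_3),
      randomized_learner A ->
      exists rs : nat -> relevance 3,
        ((c * T%:R `^ (2%:R / 3%:R))%:E <= expected_regret P A rs T)%E.
Proof.
(* [T >= 27] gives [e <= 1 / 3], so that [3 * e + e ^+ 3 * T <= 1 + 1]. *)
exists (1 / 4), 27%N; split=> [|T T27 dsp Omega P A mA]; first by lra.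
pose y : R := T%:R `^ (1 / 3).
have y3 : y ^+ 3 = T%:R.
  by rewrite -powR_mulrn ?powR_ge0// -powRrM divfK// powRr1.
have -> : T%:R `^ (2%:R / 3%:R) = y ^+ 2 :> R.
  by rewrite -powR_mulrn ?powR_ge0// -powRrM; congr (_ `^ _); field.
have y_ge3 : 3 <= y.
  rewrite leNgt; apply/negP => ylt3.
  have : y ^+ 3 < 3 ^+ 3 by rewrite ltrXn2r// powR_ge0.
  by rewrite y3 -natrX ltr_nat ltnNge T27.
have y0 : 0 < y by lra.
pose e : R := y^-1.
have e0 : 0 < e by rewrite invr_gt0.
have ey : e * y = 1 by rewrite mulVf// gt_eqF.
have e3 : 3 * e <= 1 by nra.
have eT : e * T%:R = y ^+ 2 by rewrite -y3 exprS mulrA ey mul1r.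
have e3T : e ^+ 3 * T%:R = 1 by rewrite -y3 -exprMn ey expr1n.
pose L l w : R := (learner_loss (A w) (bits_relevance l) T)%:R.
pose best l : R := (best_loss (bits_relevance l) T)%:R.
have iL l : P.-integrable setT (EFin \o L l).
  exact: integrable_learner_loss.
pose f l : R := \int[P]_w L l w - best l.
suff [l fl] : exists l, 1 / 4 * y ^+ 2 <= f l.
  exists (bits_relevance l); rewrite /expected_regret expectation.unlock.
  by rewrite -(fineK (integrable_fin_num measurableT (iL l))) lee_fin.
(* If every coin sequence had small regret, so would the average under each bias. *)
apply: contrapT => /forallNP nf.
have flt l : f l < 1 / 4 * y ^+ 2 by rewrite ltNge; apply/negP/nf.
have p01 : 0 < (1 + e) / 2 < 1 by lra.
have q01 : 0 < (1 - e) / 2 < 1 by lra.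
have := bits_mean_lt R _ T f _ p01 flt; have := bits_mean_lt R _ T f _ q01 flt.
rewrite !bits_meanB.
have best_mean p s : 0 < p < 1 -> bits_mean R p T best <=
    T%:R * (p * (SumLoss s (bit_relevance true))%:R +
            (1 - p) * (SumLoss s (bit_relevance false))%:R).
  move=> p01'; rewrite -fixed_loss_mean; apply: ler_bits_mean => // l.
  by rewrite ler_nat /best_loss; case: arg_minnP => // s0 _; apply.
(* The identity suits the bias towards item 1, the transposition the opposite bias; each has mean
   loss [7 / 2 - e / 2] per round. *)
have := best_mean _ 1%g p01; have := best_mean _ (tperm item1 item2) q01.
rewrite !SumLoss_bit_relevance tpermV invg1 !perm1 tpermL tpermR tpermD//=.
have [ip ep] := bits_mean_Rintegral P ((1 + e) / 2) T L iL.
have [iq eq] := bits_mean_Rintegral P ((1 - e) / 2) T L iL.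
(* The prior weights are [u = v = 1], of ambiguity [1 / 2]. The two mean regrets thus sum to at
   least [e * T / 2], against the assumed bound [y ^+ 2 / 4] on each. *)
have : 2 * (T%:R * (7 / 2 - e / 2)) + e * T%:R / 2 <=
    bits_mean R ((1 + e) / 2) T (fun l => \int[P]_w L l w) +
    bits_mean R ((1 - e) / 2) T (fun l => \int[P]_w L l w).
  rewrite -ep -eq -RintegralD//; set K := leLHS.
  have <- : \int[P]_w (cst K w) = K.
    by rewrite Rintegral_cst//= probability_setT mulr1.
  apply: le_Rintegral => //.
  - exact: finite_measure_integrable_cst.
  - exact: (integrableD measurableT ip iq).
  - move=> w _; have := deterministic_regret R e T (A w) 1 1 e0.
    by rewrite /ambiguity !mul1r (_ : 1 + 1 = 2)//; apply=> //; lra.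
rewrite /bump !add0n /=; lra.
Qed.
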